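(* $\mathfrak{r}_{1/2}\le\mathfrak{i}_{\mathsf{d}}$.
   Context: Let $\omega=\{0,1,2,\ldots\}$ and identify $n\in\omega$ with $\{0,\ldots,n-1\}$. $\mathcal{D}$ is the family of all $A\subseteq\omega$ for which the asymptotic density $\mathsf{d}(A):=\lim_{n\to\infty}|A\cap n|/n$ exists. For $\mathcal{A}\subseteq\mathcal{P}(\omega)$, $\langle\mathcal{A}\rangle$ denotes the field of subsets of $\omega$ generated by $\mathcal{A}$. A nonempty family $\mathcal{A}\subseteq\mathcal{D}$ is $\mathsf{d}$-independent if: (1) $\mathsf{d}(A)\in(0,1)$ for all $A\in\mathcal{A}$; (2) $\langle\mathcal{A}\rangle\subseteq\mathcal{D}$; (3) $\mathsf{d}(\bigcap\mathcal{F})=\prod_{A\in\mathcal{F}}\mathsf{d}(A)$ for every nonempty finite $\mathcal{F}\subseteq\mathcal{A}$. It is a maximal $\mathsf{d}$-independent family if it is $\mathsf{d}$-independent and not properly contained in another $\mathsf{d}$-independent family. $\mathfrak{i}_{\mathsf{d}}$ denotes the least cardinality of a maximal $\mathsf{d}$-independent family. A family $\mathcal{R}$ of infinite subsets of $\omega$ is $1/2$-reaping if there is no infinite $S\subseteq\omega$ such that $\lim_{n\to\infty}\frac{|S\cap B\cap n|}{|B\cap n|}=\frac12$ for all $B\in\mathcal{R}$. $\mathfrak{r}_{1/2}$ denotes the least cardinality of a $1/2$-reaping family. *)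

(* Defs.v *)
From HB Require Import structures.
From mathcomp Require Import all_boot all_order all_algebra.
From mathcomp Require Import finmap.
From mathcomp Require Import all_classical all_reals all_analysis.
Set Implicit Arguments.
Unset Strict Implicit.
Unset Printing Implicit Defensive.
Import Order.TTheory GRing.Theory Num.Theory.
Import numFieldNormedType.Exports.

Local Open Scope classical_set_scope.
Local Open Scope card_scope.
Local Open Scope ring_scope.

(* [`I_n] is {0, ..., n-1}, so this is |A ∩ n|. *)
Definition card_upto (A : set nat) (n : nat) : nat :=
  #|` fset_set (A `&` `I_n)|%fset.

(* Divisions by zero give 0 here and in [half_reaping]; this affects only
   finitely many terms (in [half_reaping], because [B] is infinite). *)
Definition density_seq (R : realType) (A : set nat) (n : nat) : R :=
  (card_upto A n)%:R / n%:R.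

(* Meaningful only for [A] in [has_density R]. *)
Definition density (R : realType) (A : set nat) : R := limn (density_seq R A).

Definition has_density (R : realType) : set (set nat) :=
  [set A | cvgn (density_seq R A)].

Definition set_field (T : Type) (G : set (set T)) : Prop :=
  [/\ G setT, setC_closed G & setU_closed G].

Definition generated_field (T : Type) (F : set (set T)) : set (set T) :=
  smallest (@set_field T) F.

Definition d_independent (R : realType) (F : set (set nat)) : Prop :=
  [/\ F !=set0,
      F `<=` has_density R,
      forall A, F A -> 0 < density R A < 1,
      generated_field F `<=` has_density R &
      forall G : {fset (set nat)}, G != fset0 -> [set` G] `<=` F ->
        density R (\bigcap_(A in [set` G]) A) = \prod_(A <- G) density R A].

Definition maximal_d_independent (R : realType) (F : set (set nat)) : Prop :=
  d_independent R F /\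
  ~ exists G : set (set nat), d_independent R G /\ F `<` G.

Definition half_reaping (R : realType) (F : set (set nat)) : Prop :=
  (forall B, F B -> infinite_set B) /\
  ~ exists S : set nat, infinite_set S /\
      forall B, F B ->
        (fun n => (card_upto (S `&` B) n)%:R / (card_upto B n)%:R : R) @ \oo
          --> (2^-1 : R).

Definition least_cardinality (P : set (set (set nat))) (F : set (set nat)) :
    Prop :=
  P F /\ forall G, P G -> F #<= G.

(* The least cardinality of a member of [P], as a cardinal represented by a
   chosen member of [P] of least cardinality; such cardinals are compared by
   [#<=].  Cardinals being well-ordered, the default [set0] is used only when
   [P] is empty. *)
Definition min_card (P : set (set (set nat))) : set (set nat) :=
  xget set0 [set F | least_cardinality P F].

Definition r_half (R : realType) : set (set nat) := min_card (half_reaping R).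

Definition i_d (R : realType) : set (set nat) :=
  min_card (maximal_d_independent R).

(* Main.v *)
Require Import Defs.
From mathcomp Require Import all_boot all_order all_algebra.
From mathcomp Require Import finmap ring lra.
From mathcomp Require Import all_classical all_reals all_analysis.

Import Order.TTheory GRing.Theory Num.Theory.
Import numFieldNormedType.Exports.

Local Open Scope classical_set_scope.
Local Open Scope card_scope.

(** Let [F] be a maximal d-independent family. If a single [S] bisected every
    infinite member of the field generated by [F], then
    [density (S `&` B) = density B / 2] for all [B] in that field, so
    [S |` F] would be d-independent, while [S] is not in [F] because
    [density (S `&` S)] is not [density S / 2]. Hence the infinite members of
    the field form a 1/2-reaping family. A finite [F] colours [nat] with
    finitely many colours, and taking every other point of each colour gives
    such an [S]; so [F] is infinite, and the field it generates has the
    cardinality of [F]. *)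

(** * Cardinal arithmetic *)

Lemma card_le_inj {T U : Type} (A : set T) (B : set U) (f : T -> U) :
  (forall x, A x -> B (f x)) ->
  (forall x y, A x -> A y -> f x = f y -> x = y) -> A #<= B.
Proof.
move=> fAB finj; have : $|{injfun A >-> B}|.
  by apply/injfunPex; exists f => // x y /set_mem Ax /set_mem Ay; exact: finj.
by case=> g; exact: inj_card_le g.
Qed.

Lemma card_le_injE {T : Type} {U : pointedType} (A : set T) (B : set U) :
  A #<= B -> exists f : T -> U, (forall x, A x -> B (f x)) /\
    (forall x y, A x -> A y -> f x = f y -> x = y).
Proof.
move=> /pcard_leP/injfunPex[f fAB finj]; exists f; split=> // x y Ax Ay.
by apply: finj; exact: mem_set.
Qed.

(** Zorn's lemma for the sets [Y] such that [P] holds of the union of [X0] and [Y]. The empty chain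
    then gives [X0] itself, so a hypothesis on nonempty chains suffices. *)
Lemma Zorn_bigcup_above {T : Type} (P : set (set T)) (X0 : set T) :
  P X0 ->
  (forall F : set (set T), F !=set0 -> F `<=` P -> total_on F subset ->
    P (\bigcup_(X in F) X)) ->
  exists M, [/\ P M, X0 `<=` M & forall B, M `<` B -> ~ P B].
Proof.
move=> PX0 Pchain.
have [F FP Ftot|Y [PY Ymax]] := @Zorn_bigcup T [set Y | P (X0 `|` Y)].
  have [->|/set0P[Y0 FY0]] := eqVneq F set0.
    by rewrite /= bigcup_set0 setU0.
  rewrite /=; have -> : X0 `|` \bigcup_(X in F) X =
      \bigcup_(X in [set X0 `|` Y | Y in F]) X.
    apply/seteqP; split=> x.
      by case=> [X0x|[Y FY Yx]]; [exists (X0 `|` Y0); [exists Y0|left]|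
        exists (X0 `|` Y); [exists Y|right]].
    by case=> _ [Y FY <-] [X0x|Yx]; [left|right; exists Y].
  apply: Pchain.
  - by exists (X0 `|` Y0), Y0.
  - by move=> _ [Y FY <-]; exact: FP.
  - move=> _ _ [Y FY <-] [Z FZ <-].
    by have [YZ|ZY] := Ftot _ _ FY FZ; [left|right]; exact: setUS.
exists (X0 `|` Y); split=> // B [sub nsub] PB.
have X0B : X0 `<=` B by move=> x X0x; apply: sub; left.
apply: (Ymax B); last by rewrite /= (setUidr X0B).
split; first by move=> x Yx; apply: sub; right.
by move=> BY; apply: nsub => x Bx; right; exact: BY.
Qed.

(* A maximal set of choice functions any two of which differ at every member
   of [P] is mapped by evaluation onto some member of [P], and injectively into
   all of them. *)
Lemma exists_least_card {T : pointedType} (P : set (set T)) :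
  P !=set0 -> exists2 A, P A & forall B, P B -> A #<= B.
Proof.
case=> A0 PA0.
pose Q (Z : set (set T -> T)) :=
  (forall f B, Z f -> P B -> B (f B)) /\
  (forall f g B, Z f -> Z g -> P B -> f B = g B -> f = g).
have [F FQ Ftot|Z [[Zsub Zinj] Zmax]] := @Zorn_bigcup _ Q.
  split=> [f B [Z FZ Zf] PB|f g B [Z FZ Zf] [Y FY Yg] PB fg].
    exact: (FQ _ FZ).1 Zf PB.
  have [ZY|YZ] := Ftot _ _ FZ FY.
    by exact: (FQ _ FY).2 (ZY _ Zf) Yg PB fg.
  by exact: (FQ _ FZ).2 Zf (YZ _ Yg) PB fg.
have [A [PA Asurj]] : exists A, P A /\ A `<=` (fun f => f A) @` Z.
  (* Otherwise every member of [P] has a point that no function of [Z] takes as its value there; a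
     choice [h] of such points could be added to [Z]. *)
  apply: contrapT => nA.
  have pickP B : exists y, P B -> B y /\ ~ ((fun f => f B) @` Z) y.
    have [PB|] := pselect (P B); last by exists point.
    apply: contrapT => nB; apply: nA; exists B; split=> // y By.
    by apply: contrapT => nZ; apply: nB; exists y.
  have [h hP] := choice pickP.
  apply: (Zmax (h |` Z)).
    split; first by move=> f; right.
    move=> /(_ h (or_introl erefl)) Zh; apply: (hP A0 PA0).2.
    by exists h.
  split=> [f B [->|Zf] PB|f g B [->|Zf] [->|Zg] PB fg //].
  - exact: (hP B PB).1.
  - exact: Zsub Zf PB.
  - by case: (hP B PB).2; exists g.
  - by case: (hP B PB).2; exists f.
  - exact: Zinj PB fg.
exists A => // B PB.
apply: card_le_trans (subset_card_le Asurj) _.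
apply: card_le_trans (card_image_le _ _) _.
apply: (@card_le_inj _ _ _ _ (fun f : set T -> T => f B)) => [f Zf|f g Zf Zg].
  exact: Zsub Zf PB.
exact: Zinj.
Qed.

Lemma card_le_total {T : pointedType} (A B : set T) : A #<= B \/ B #<= A.
Proof.
have [|C [->|->] le] := @exists_least_card T [set A; B]; first by exists A; left.
  by left; apply: le; right.
by right; apply: le; left.
Qed.

(** * Hessenberg's theorem: an infinite set absorbs its square *)

Section Hessenberg.
Context (T : pointedType) (F : set T).

(** A graph determines its carrier as the diagonal of its domain, so inclusion of graphs orders
    carriers and injections together. *)
Let field (G : set (T * T * T)) (x : T) := exists z, G (x, x, z).

(* [G] is the graph of an injection from [A `*` A] to [A], with [A = field G]
   a subset of [F]. *)
Let square_inj (G : set (T * T * T)) := [/\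
  forall x y z, G (x, y, z) -> [/\ field G x, field G y, field G z & F x],
  forall x y z z', G (x, y, z) -> G (x, y, z') -> z = z',
  forall x y x' y' z, G (x, y, z) -> G (x', y', z) -> x = x' /\ y = y' &
  forall x y, field G x -> field G y -> (exists z, G (x, y, z))].

Let graph (A : set T) (f : T -> T -> T) : set (T * T * T) :=
  [set t | [/\ A t.1.1, A t.1.2 & t.2 = f t.1.1 t.1.2]].

Let inj2 (A : set T) (f : T -> T -> T) := [/\ A `<=` F,
  forall x y, A x -> A y -> A (f x y) &
  forall x y x' y', A x -> A y -> A x' -> A y' -> f x y = f x' y' ->
    x = x' /\ y = y'].

Let square_inj_graph A f : inj2 A f -> square_inj (graph A f).
Proof.
case=> AF fA finj.
have fieldE x : field (graph A f) x <-> A x.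
  by split=> [[z []]|Ax] //; exists (f x x).
split=> [x y z [/= Ax Ay ->]|x y z z' [/= _ _ ->] [/= _ _ ->] //|
  x y x' y' z [/= Ax Ay ->] [/= Ax' Ay'] //|x y].
- by split; [exact/fieldE|exact/fieldE|apply/fieldE; exact: fA|exact: AF].
- exact: finj.
- by move=> /fieldE Ax /fieldE Ay; exists (f x y).
Qed.

Let square_injE G : square_inj G -> exists A f, G = graph A f /\ inj2 A f.
Proof.
case=> Gf Gfun Ginj Gtot; exists (field G).
have pickP (p : T * T) :
    exists z, field G p.1 -> field G p.2 -> G (p.1, p.2, z).
  have [[p1 p2]|np] := pselect (field G p.1 /\ field G p.2).
    by have [z Gz] := Gtot _ _ p1 p2; exists z.
  by exists point => p1 p2; exfalso; apply: np.
have [f fP] := choice pickP.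
have {}fP x y : field G x -> field G y -> G (x, y, f (x, y)) := fP (x, y).
exists (fun x y => f (x, y)); split; last split.
- apply/seteqP; split=> [[[x y] z] Gxyz|[[x y] z] [/= Ax Ay ->]]; last exact: fP.
  have [Ax Ay _ _] := Gf _ _ _ Gxyz.
  by split=> //=; apply: Gfun Gxyz _; exact: fP.
- by move=> x [z /Gf[]].
- by move=> x y Ax Ay; have [] := Gf _ _ _ (fP _ _ Ax Ay).
- move=> x y x' y' Ax Ay Ax' Ay' e.
  by apply: (Ginj _ _ _ _ _ (fP _ _ Ax Ay)); rewrite e; exact: fP.
Qed.

(** Each clause of [square_inj] assumes at most two triples, and in a chain two triples lie in a
    common member. *)
Let square_inj_bigcup (C : set (set (T * T * T))) :
  C `<=` square_inj -> total_on C subset -> square_inj (\bigcup_(G in C) G).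
Proof.
move=> Csq Ctot.
have fieldP G x : C G -> field G x -> field (\bigcup_(G in C) G) x.
  by move=> CG [z Gz]; exists z, G.
have two t u : (\bigcup_(G in C) G) t -> (\bigcup_(G in C) G) u ->
    exists G, [/\ C G, G t & G u].
  move=> [G CG Gt] [H CH Hu]; have [GH|HG] := Ctot _ _ CG CH.
    by exists H; split=> //; exact: GH.
  by exists G; split=> //; exact: HG.
split.
- move=> x y z [G CG Gxyz]; have [Gf _ _ _] := Csq _ CG.
  by have [Gx Gy Gz Fx] := Gf _ _ _ Gxyz; split=> //; exact: (fieldP G).
- move=> x y z z' /two/[apply] -[G [CG]].
  by have [_ Gfun _ _] := Csq _ CG; exact: Gfun.
- move=> x y x' y' z /two/[apply] -[G [CG]].
  by have [_ _ Ginj _] := Csq _ CG; exact: Ginj.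
- move=> x y [z /two +] [z' Gz'] => /(_ _ Gz')[G [CG Gx Gy]].
  have [_ _ _ Gtot] := Csq _ CG.
  by have [||w Gw] := Gtot x y; [exists z|exists z'|exists w, G].
Qed.

(** Take a maximal injection [f] from the square of some subset [A] of [F] to [A]. If the rest of
    [F] embeds in [A], then so does [F], by tagging, and [f] turns this into an embedding of the
    square of [F]. Otherwise [A] has a copy in the rest of [F], which leaves room to extend [f],
    against maximality. *)
Lemma card_setX_infinite : infinite_set F -> F `*` F #<= F.
Proof.
move=> /infiniteP/card_le_injE[e [eF einj]].
have {}einj m n : e m = e n -> m = n by exact: einj.
have [r rP] : exists r : T -> nat, forall n, r (e n) = n.
  have /choice[r rP] : forall x, exists n, forall m, x = e m -> n = m.
    move=> x; have [[n ->]|nx] := pselect (exists n, x = e n).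
      by exists n => m /einj.
    by exists 0%N => m xm; exfalso; apply: nx; exists m.
  by exists r => n; exact: rP.
(* The start for Zorn's lemma: a pairing of natural numbers, carried to the countable subset
   [range e] of [F]. *)
pose f0 x y := e (choice.pickle (r x, r y)).
have sq0 : square_inj (graph (range e) f0).
  apply: square_inj_graph; split.
  - by move=> _ [n _ <-]; exact: eF.
  - by move=> _ _ [m _ <-] [n _ <-]; exists (choice.pickle (m, n)); rewrite /f0 ?rP.
  - move=> _ _ _ _ [m _ <-] [n _ <-] [m' _ <-] [n' _ <-] /einj.
    by rewrite !rP => /(pcan_inj choice.pickleK)[-> ->].
have [M [sqM sub Mmax]] := Zorn_bigcup_above _ _ sq0
  (fun C _ => square_inj_bigcup C).
have [A [f [ME [AF fA finj]]]] := square_injE _ sqM.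
have Ae n : A (e n).
  have [/= + _ _] : graph A f (e n, e n, f0 (e n) (e n)).
    by rewrite -ME; apply: sub; split=> //=; exists n.
  by [].
(* Four distinct elements of [A], serving as tags. *)
pose c (a b : bool) := e (choice.pickle (a, b)).
have cinj a b a' b' : c a b = c a' b' -> a = a' /\ b = b'.
  by move=> /einj/(pcan_inj choice.pickleK)[-> ->].
have Ac a b : A (c a b) by exact: Ae.
have [|] := card_le_total (F `\` A) A => /card_le_injE[h [hA hinj]].
  (* The tags keep the image of [A] apart from that of the rest of [F]. *)
  pose u x := if `[< A x >] then f (c true true) x else f (c false false) (h x).
  have uA x : F x -> A (u x).
    by move=> Fx; rewrite /u; case: asboolP => Ax; apply: fA => //; exact: hA.
  have uinj x y : F x -> F y -> u x = u y -> x = y.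
    move=> Fx Fy; rewrite /u.
    case: asboolP => Ax; case: asboolP => Ay /finj[]//.
    - exact: hA.
    - by move=> /cinj[].
    - exact: hA.
    - by move=> /cinj[].
    - exact: hA.
    - exact: hA.
    - by move=> _ /hinj ->.
  apply: (@card_le_inj _ _ _ _ (fun p => f (u p.1) (u p.2))).
    by move=> [x y] [/= Fx Fy]; apply/AF/fA; exact: uA.
  move=> [x y] [x' y'] [/= Fx Fy] [/= Fx' Fy'] /finj[]; try exact: uA.
  by move=> /uinj -> // /uinj ->.
exfalso.
pose A' := A `|` h @` A.
have /choice[s sP] x : exists w, A' x ->
    A w /\ x = if `[< A x >] then w else h w.
  case: asboolP => Ax; first by exists x.
  have [[y Ay <-]|nx] := pselect ((h @` A) x); first by exists y.
  by exists x => -[].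
(* [s] undoes [h] on the copy of [A]. Pairs not within [A] are sent into the copy, hence away from
   the values of [f]; the tag records which coordinates lie in [A], and together with [s] it
   determines both. *)
pose f' x y := if `[< A x >] && `[< A y >] then f x y
  else h (f (c `[< A x >] `[< A y >]) (f (s x) (s y))).
have As x : A' x -> A (s x) by move=> /sP[].
have nhA x : A x -> ~ A (h x) by move=> /hA[].
have Af' x y : A' x -> A' y -> A (f (c `[< A x >] `[< A y >]) (f (s x) (s y))).
  by move=> /As Ax /As Ay; apply: (fA) => //; exact: fA.
have f'inj x y x' y' : A' x -> A' y -> A' x' -> A' y' -> f' x y = f' x' y' ->
    x = x' /\ y = y'.
  move=> Ax Ay Ax' Ay'; rewrite /f'.
  case: ifPn => [/andP[/asboolP x1 /asboolP y1]|_];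
  case: ifPn => [/andP[/asboolP x2 /asboolP y2]|_].
  - exact: finj.
  - by move=> E; case: (nhA _ (Af' _ _ Ax' Ay')); rewrite -E; exact: fA.
  - by move=> E; case: (nhA _ (Af' _ _ Ax Ay)); rewrite E; exact: fA.
  move=> /hinj-/(_ (Af' _ _ Ax Ay) (Af' _ _ Ax' Ay')) /finj[].
  - exact: Ac.
  - by apply: fA; exact: As.
  - exact: Ac.
  - by apply: fA; exact: As.
  move=> /cinj[xx' yy'] /finj[]; try exact: As.
  move=> sx sy; split.
    by move: (sP _ Ax).2 (sP _ Ax').2; rewrite xx' sx => -> <-.
  by move: (sP _ Ay).2 (sP _ Ay').2; rewrite yy' sy => -> <-.
apply: (Mmax (graph A' f')); last first.
  apply: square_inj_graph; split=> //.
  - by move=> x [/AF|[y /hA[+ _] <-]].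
  - move=> x y Ax Ay; rewrite /f'; case: ifPn.
      by move=> /andP[/asboolP x1 /asboolP y1]; left; exact: fA.
    move=> _; right; exists (f (c `[< A x >] `[< A y >]) (f (s x) (s y))) => //.
    exact: Af'.
rewrite ME; split.
  move=> [[x y] z] [/= Ax Ay ->]; split=> //=; [by left|by left|].
  by rewrite /f' !asboolT.
(* [h (e 0)] lies in the copy, so its triple is new and the extension is proper. *)
have hA' : A' (h (e 0)) by right; exists (e 0).
move=> /(_ (h (e 0), h (e 0), f' (h (e 0)) (h (e 0)))) [] //=.
by have /nhA := Ae 0%N.
Qed.

End Hessenberg.

(** * Terms over the generators and the size of the generated field *)

Inductive field_term (T : Type) : Type :=
| Generator of T
| Complement of field_term T
| Union of field_term T & field_term T.
Arguments Generator {T}.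
Arguments Complement {T}.
Arguments Union {T}.

Fixpoint eval_term {T : Type} (t : field_term (set T)) : set T :=
  match t with
  | Generator A => A
  | Complement t => ~` eval_term t
  | Union t u => eval_term t `|` eval_term u
  end.

Fixpoint over {T : Type} (F : set T) (t : field_term T) : Prop :=
  match t with
  | Generator x => F x
  | Complement t => over F t
  | Union t u => over F t /\ over F u
  end.

(** A term is coded by iterating an injection [p] from the square of [F] to [F], with [e 0], [e 1],
    [e 2] marking the outermost constructor. *)
Lemma card_field_term {T : pointedType} (F : set T) :
  infinite_set F -> over F #<= F.
Proof.
move=> Finf; have /card_le_injE[p [pF pinj]] := card_setX_infinite _ _ Finf.
have {}pF x y : F x -> F y -> F (p (x, y)) by move=> Fx Fy; exact: pF.
have {}pinj x y x' y' : F x -> F y -> F x' -> F y' -> p (x, y) = p (x', y') ->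
    x = x' /\ y = y'.
  move=> Fx Fy Fx' Fy'.
  by move=> /(pinj (x, y) (x', y') (conj Fx Fy) (conj Fx' Fy'))[-> ->].
have /infiniteP/card_le_injE[e [eF einj]] := Finf.
have {}eF n : F (e n) by exact: eF.
have {}einj m n : e m = e n -> m = n by exact: einj.
pose code := fix code (t : field_term T) : T :=
  match t with
  | Generator x => p (e 0, x)
  | Complement t => p (e 1, code t)
  | Union t u => p (e 2, p (code t, code u))
  end.
have codeF t : over F t -> F (code t).
  elim: t => [x|t IH|t IHt u IHu] /= => [Fx|/IH Ft|[/IHt Ft /IHu Fu]].
  - exact: pF.
  - exact: pF.
  - by apply: (pF) => //; exact: pF.
apply: (@card_le_inj _ _ _ _ code) => //.
elim=> [x|t IH|t IHt u IHu] [y|t'|t' u'] /=.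
- by move=> Fx Fy /pinj[]// _ ->.
- by move=> Fx /codeF Ft' /pinj[]// /einj.
- by move=> Fx [/codeF Ft' /codeF Fu'] /pinj[]//; [exact: pF|move=> /einj].
- by move=> /codeF Ft Fy /pinj[]// /einj.
- move=> Ft Ft' /pinj[]//; [exact: codeF|exact: codeF|].
  by move=> _ /IH ->.
- by move=> /codeF Ft [/codeF Ft' /codeF Fu'] /pinj[]//; [exact: pF|move=> /einj].
- by move=> [/codeF Ft /codeF Fu] Fy /pinj[]//; [exact: pF|move=> /einj].
- by move=> [/codeF Ft /codeF Fu] /codeF Ft' /pinj[]//; [exact: pF|move=> /einj].
- move=> [Ft Fu] [Ft' Fu'] /pinj[]//; try by apply: pF; exact: codeF.
  by move=> _ /pinj[]; try exact: codeF; move=> /IHt -> // /IHu ->.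
Qed.

(** The values of terms over [F] form a field containing [F], so the generated field has at most as
    many members as there are terms. *)
Lemma card_generated_field {T : pointedType} (F : set (set T)) :
  infinite_set F -> generated_field F #<= F.
Proof.
move=> Finf; apply: card_le_trans (card_field_term _ Finf).
apply: card_le_trans (card_image_le eval_term _); apply: subset_card_le.
apply: smallest_sub; last by move=> A FA; exists (Generator A).
split.
- have [A FA] := infinite_setN0 Finf.
  (* No constructor denotes the full set, so it is written as a generator joined with its
     complement. *)
  exists (Union (Generator A) (Complement (Generator A))) => //=.
  exact: setUv.
- by move=> _ [t Ft <-]; exists (Complement t).
- by move=> _ _ [t Ft <-] [u Fu <-]; exists (Union t u).
Qed.

(** * Density and generated fields *)

Local Open Scope ring_scope.

Lemma sub_generated_field {T : Type} (F : set (set T)) A :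
  F A -> generated_field F A.
Proof. by move=> FA X [_]; exact. Qed.

Lemma set_field_generated {T : Type} (F : set (set T)) :
  set_field (generated_field F).
Proof.
split=> [X [[]] //|A FA X [XF FX]|A B FA FB X [XF FX]]; have [_ XC XU] := XF.
  by apply: XC; exact: FA.
by apply: XU; [exact: FA|exact: FB].
Qed.

Lemma generated_fieldT {T : Type} (F : set (set T)) : generated_field F setT.
Proof. by have [] := set_field_generated F. Qed.

Lemma generated_fieldC {T : Type} (F : set (set T)) A :
  generated_field F A -> generated_field F (~` A).
Proof. by have [_ + _] := set_field_generated F; exact. Qed.

Lemma generated_fieldU {T : Type} (F : set (set T)) A B :
  generated_field F A -> generated_field F B -> generated_field F (A `|` B).
Proof. by have [_ _ +] := set_field_generated F; exact. Qed.

Lemma generated_fieldI {T : Type} (F : set (set T)) A B :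
  generated_field F A -> generated_field F B -> generated_field F (A `&` B).
Proof.
move=> FA FB; rewrite -(setCK (A `&` B)) setCI.
by apply: generated_fieldC; apply: generated_fieldU; apply: generated_fieldC.
Qed.

Lemma generated_field_bigcap {T : choiceType} (F : set (set T))
    (s : seq (set T)) :
  (forall A, A \in s -> F A) -> generated_field F (\bigcap_(A in [set` s]) A).
Proof.
move=> sF; rewrite bigcap_seq big_seq; apply: big_ind => [|A B|A /sF].
- exact: generated_fieldT.
- exact: generated_fieldI.
- exact: sub_generated_field.
Qed.

(** The sets of this form already make up a field containing [S] and [F], since complements and
    unions can be taken separately inside and outside [S]. *)
Lemma generated_field_setU1 {T : Type} (F : set (set T)) (S B : set T) :
  generated_field (S |` F) B -> exists C D,
    [/\ generated_field F C, generated_field F D &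
        B = (S `&` C) `|` (~` S `&` D)].
Proof.
pose K := [set B | exists C D, [/\ generated_field F C, generated_field F D &
        B = (S `&` C) `|` (~` S `&` D)]].
suff: generated_field (S |` F) `<=` K by exact.
apply: smallest_sub => [|A [->|FA]]; last first.
- exists A, A; split; try exact: sub_generated_field.
  by rewrite -setIUl setUv setTI.
- exists setT, set0; rewrite setIT setI0 setU0; split=> //.
    exact: generated_fieldT.
  by rewrite -setCT; apply: generated_fieldC; exact: generated_fieldT.
split.
- exists setT, setT; rewrite !setIT setUv; split=> //; exact: generated_fieldT.
- move=> _ [C [D [FC FD ->]]]; exists (~` C), (~` D).
  split; [exact: generated_fieldC|exact: generated_fieldC|].
  apply/seteqP; split=> x /=; have [Sx|nSx] := pselect (S x).
  + by move=> h; left; split=> // Cx; apply: h; left.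
  + by move=> h; right; split=> // Dx; apply: h; right.
  + by move=> [[_ nC]|[]//] [[]|[]].
  + by move=> [[]//|[_ nD]] [[]|[]].
- move=> _ _ [C [D [FC FD ->]]] [C' [D' [FC' FD' ->]]].
  exists (C `|` C'), (D `|` D').
  split; [exact: generated_fieldU|exact: generated_fieldU|].
  by rewrite !setIUr setUACA.
Qed.

(** * Counting the elements below a bound *)

Lemma card_uptoE (A : set nat) n :
  card_upto A n = count (fun i => `[< A i >]) (iota 0 n).
Proof.
rewrite -size_filter /card_upto; apply/perm_size/uniq_perm.
- exact: fset_uniq.
- exact/filter_uniq/iota_uniq.
move=> i; rewrite in_fset_set; last exact/finite_setIr/finite_II.
rewrite mem_filter mem_iota add0n /=.
by apply/idP/idP => [/set_mem[Ai ->]|/andP[/asboolP Ai i_lt]];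
  [rewrite andbT; exact/asboolP|exact: mem_set].
Qed.

Lemma card_upto_setIC (S A : set nat) n :
  (card_upto (S `&` A) n + card_upto (~` S `&` A) n = card_upto A n)%N.
Proof.
rewrite !card_uptoE; elim: (iota 0 n) => //= i s <-.
rewrite addnACA; congr addn; rewrite !asbool_and asbool_neg.
by case: `[< S i >]; rewrite /= ?addn0.
Qed.

Lemma card_uptoT n : card_upto setT n = n.
Proof.
rewrite card_uptoE -[RHS](size_iota 0 n) -count_predT; apply: eq_count => i /=.
exact: asboolT.
Qed.

Lemma card_upto_le (A B : set nat) n :
  A `<=` B -> (card_upto A n <= card_upto B n)%N.
Proof.
move=> AB; rewrite !card_uptoE; apply: sub_count => i /asboolP Ai.
by apply/asboolP; exact: AB.
Qed.

Lemma card_upto_infinite (A : set nat) (M : nat) :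
  infinite_set A -> exists N, forall n, (N <= n)%N -> (M <= card_upto A n)%N.
Proof.
move=> /infinite_set_fset-/(_ M)[X XA MX].
exists (\max_(x <- X) x).+1 => n Nn; apply: leq_trans MX _.
rewrite card_uptoE -size_filter; apply: uniq_leq_size; first exact: fset_uniq.
move=> x xX; rewrite mem_filter mem_iota /= add0n.
apply/andP; split; first by apply/asboolP; exact: XA.
by apply: leq_trans Nn; rewrite ltnS; exact: leq_bigmax_seq.
Qed.

(** * Densities of bisected sets, and independent families *)

Section Density.
Context (R : realType).

Lemma density_seq_setIC (S A : set nat) n :
  density_seq R (S `&` A) n + density_seq R (~` S `&` A) n = density_seq R A n.
Proof. by rewrite /density_seq -mulrDl -natrD card_upto_setIC. Qed.

Lemma cvg_densityT : density_seq R setT @ \oo --> (1 : R).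
Proof.
apply: cvg_near_cst.
exists 1%N => // n /= n_gt0.
by rewrite /density_seq card_uptoT divff// pnatr_eq0 -lt0n.
Qed.

Lemma densityT : density R setT = 1.
Proof. exact: cvg_lim cvg_densityT. Qed.

Definition bisects (S B : set nat) : Prop :=
  (fun n => (card_upto (S `&` B) n)%:R / (card_upto B n)%:R : R) @ \oo
    --> (2^-1 : R).

Lemma cvg_density_bisects (S B : set nat) : has_density R B -> bisects S B ->
  density_seq R (S `&` B) @ \oo --> density R B / 2.
Proof.
move=> dB SB; rewrite mulrC.
rewrite (_ : density_seq R (S `&` B) = (fun n =>
  (card_upto (S `&` B) n)%:R / (card_upto B n)%:R * density_seq R B n)).
  exact: cvgM SB dB.
apply/funext => n; rewrite /density_seq mulrA; congr (_ / _).
(* Where [B] has no element below [n], the quotient is 0 by convention, and the count of its part in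
   [S] is 0 too. *)
have [B0|Bn0] := eqVneq (card_upto B n) 0%N; last by rewrite divfK// pnatr_eq0.
have := @card_upto_le (S `&` B) B n (@subIsetr _ _ _).
by rewrite B0 leqn0 => /eqP->; rewrite !mul0r.
Qed.

(* If [B] is finite then [~` B] is infinite, and
   [S `&` B] is [S] minus [S `&` ~` B]. *)
Lemma cvg_density_bisects_field (G : set (set nat)) (S B : set nat) :
  generated_field G `<=` has_density R ->
  (forall B, generated_field G B -> infinite_set B -> bisects S B) ->
  generated_field G B -> density_seq R (S `&` B) @ \oo --> density R B / 2.
Proof.
move=> GD GS GB; have [Bfin|Binf] := pselect (finite_set B); last first.
  by apply: cvg_density_bisects; [exact: GD|exact: GS].
have GCB := generated_fieldC _ _ GB; have GT := generated_fieldT G.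
have CBinf : infinite_set (~` B).
  by rewrite -setTD; apply: infinite_setD => //; exact: infinite_nat.
have dT := cvg_density_bisects _ _ (GD _ GT) (GS _ GT infinite_nat).
have dC := cvg_density_bisects _ _ (GD _ GCB) (GS _ GCB CBinf).
have dB : density R B = 1 - density R (~` B).
  apply: cvg_lim => //; rewrite (_ : density_seq R B =
    (fun n => density_seq R setT n - density_seq R (~` B) n)).
    by apply: cvgB; [exact: cvg_densityT|exact: GD].
  apply/funext => n; rewrite -(density_seq_setIC B setT).
  by rewrite !setIT addrK.
rewrite (_ : density_seq R (S `&` B) = (fun n =>
    density_seq R (S `&` setT) n - density_seq R (S `&` ~` B) n)).
  by rewrite dB mulrBl; rewrite densityT in dT; exact: cvgB dT dC.
apply/funext => n; rewrite -(density_seq_setIC B (S `&` setT)) setIT.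
by rewrite ![_ `&` S]setIC addrK.
Qed.

(* [d_independent] without the nonemptiness requirement. *)
Definition pre_d_independent (F : set (set nat)) : Prop :=
  [/\ F `<=` has_density R,
      forall A, F A -> 0 < density R A < 1,
      generated_field F `<=` has_density R &
      forall G : {fset (set nat)}, G != fset0 -> [set` G] `<=` F ->
        density R (\bigcap_(A in [set` G]) A) = \prod_(A <- G) density R A].

(** The field generated by no sets consists of the empty and the full set. This family is the seed
    of a first d-independent one. *)
Lemma pre_d_independent0 : pre_d_independent set0.
Proof.
split=> [A []|A []|B|G /fset0Pn[A AG] /(_ A AG)//].
suff : generated_field set0 `<=` has_density R by exact.
have : generated_field (@set0 (set nat)) `<=` [set set0; setT].
  apply: smallest_sub => //; split; first by right.
  - by move=> _ [|] ->; [right; rewrite setC0|left; rewrite setCT].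
  - by move=> _ _ [|] -> [|] ->; rewrite ?(set0U, setTU); by [left|right].
move=> sub B' /sub[|] ->; last by apply: cvgP; exact: cvg_densityT.
rewrite /has_density /= (_ : density_seq R set0 = (fun=> 0)).
  exact: is_cvg_cst.
apply/funext => n; rewrite /density_seq (_ : card_upto _ _ = 0)%N ?mul0r//.
by rewrite /card_upto set0I fset_set0.
Qed.

(** * Adjoining a bisecting set *)

Section Extension.
Context (F : set (set nat)) (S : set nat).
Context (F_ind : pre_d_independent F).
Context (S_bis : forall B, generated_field F B -> infinite_set B ->
  bisects S B).

Let density_S B : generated_field F B -> density R (S `&` B) = density R B / 2.
Proof.
move=> FB; have [_ _ FD _] := F_ind.
by apply: cvg_lim => //; apply: cvg_density_bisects_field FB.
Qed.

Let densityS : density R S = 2^-1.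
Proof.
by rewrite -[S]setIT density_S ?densityT ?mul1r//; exact: generated_fieldT.
Qed.

Lemma bisecting_set_notin : ~ F S.
Proof.
have [_ F01 _ _] := F_ind.
move=> FS; have := density_S _ (sub_generated_field _ _ FS).
have /andP[] := F01 _ FS.
rewrite setIid densityS => _ _; lra.
Qed.

Lemma pre_d_independent_setU1 : pre_d_independent (S |` F).
Proof.
have [FA F01 FD FM] := F_ind.
have genD : generated_field (S |` F) `<=` has_density R.
  move=> _ /generated_field_setU1[C [D [FC FD' ->]]].
  have cS B FB := cvg_density_bisects_field F S B FD S_bis FB.
  (* Inside [S] the set is the half of [C] lying in [S]; outside [S] it is [D] minus the half of [D]
     lying in [S]. *)
  apply/cvg_ex; exists (density R C / 2 + (density R D - density R D / 2)).
  rewrite (_ : density_seq R _ = (fun n => density_seq R (S `&` C) n +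
      (density_seq R D n - density_seq R (S `&` D) n))).
    by apply: cvgD (cS _ FC) _; apply: cvgB (cS _ FD'); exact: FD.
  apply/funext => n; rewrite -[LHS](density_seq_setIC S).
  rewrite -(density_seq_setIC S D) addrAC subrr add0r !setIUr !setIA.
  by rewrite !setIid setICr setICl !set0I setU0 set0U.
split=> //.
- by move=> A SFA; apply: genD; exact: sub_generated_field.
- by move=> A [->|/F01//]; rewrite densityS; apply/andP; split; lra.
move=> G G0 GF; have [SG|SnG] := boolP (S \in G); last first.
  apply: FM => // A AG; have [AS|//] := GF _ AG.
  by rewrite /= AS (negbTE SnG) in AG.
(* The factor of [S] is split off; the other sets intersect in a member of the field of [F], whose
   density [S] halves. *)
rewrite (big_fsetD1 S)//= densityS.
have HF A : A \in (G `\ S)%fset -> F A.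
  by rewrite in_fsetD1 => /andP[/eqP AS /GF[]].
have -> : \bigcap_(A in [set` G]) A =
    S `&` \bigcap_(A in [set` (G `\ S)%fset]) A.
  exact: bigcap_fsetD1.
rewrite density_S; last exact: generated_field_bigcap.
rewrite mulrC; congr (_ * _).
(* [FM] concerns nonempty families. If [S] is the only member of [G], the remaining intersection is
   the full set, whose density 1 is the empty product. *)
have [->|HS0] := eqVneq (G `\ S)%fset fset0; last exact: FM.
by rewrite big_seq_fset0 set_fset0 bigcap_set0 densityT.
Qed.

End Extension.

(** Along a chain the union of the generated fields is itself a field, and a finite subfamily of the
    union lies in one member; so each clause is inherited from a member. *)
Lemma pre_d_independent_bigcup (C : set (set (set nat))) :
  C !=set0 -> C `<=` pre_d_independent -> total_on C subset ->
  pre_d_independent (\bigcup_(F in C) F).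
Proof.
move=> [F0 CF0] CP Ctot; split.
- by move=> A [F /CP[FD _ _ _] FA]; exact: FD.
- by move=> A [F /CP[_ F01 _ _] FA]; exact: F01.
- have sub : generated_field (\bigcup_(F in C) F) `<=`
      \bigcup_(F in C) generated_field F.
    apply: smallest_sub => [|A [F CF FA]]; last first.
      by exists F => //; exact: sub_generated_field.
    split; first by exists F0 => //; exact: generated_fieldT.
      by move=> A [F CF FA]; exists F => //; exact: generated_fieldC.
    move=> A B [F CF FA] [G CG GB].
    have [FG|GF] := Ctot _ _ CF CG.
      exists G => //; apply: generated_fieldU => //.
      by apply: smallest_sub FA => //; [exact: set_field_generated|
        exact: subset_trans FG (sub_generated_field _)].
    exists F => //; apply: generated_fieldU => //.
    by apply: smallest_sub GB => //; [exact: set_field_generated|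
      exact: subset_trans GF (sub_generated_field _)].
  by move=> A /sub[F /CP[_ _ FD _] FA]; exact: FD.
move=> G G0 GC.
have seqC (s : seq (set nat)) : (forall A, A \in s -> (\bigcup_(F in C) F) A) ->
    exists2 F, C F & forall A, A \in s -> F A.
  elim: s => [_|B s IH sC]; first by exists F0.
  have [A As|F CF sF] := IH; first by apply: sC; rewrite inE As orbT.
  have [|H CH HB] := sC B; first by rewrite inE eqxx.
  have [FH|HF] := Ctot _ _ CF CH; [exists H => //|exists F => //] => A;
    rewrite inE => /predU1P[->//|/sF FA//]; [exact: FH|exact: HF].
have [F CF GF] := seqC G (fun A AG => GC A AG).
by have [_ _ _ FM] := CP _ CF; exact: FM.
Qed.

End Density.

(** * Bisecting sets for finite colourings *)

Section Coloring.
Context {T : finType} (c : nat -> T).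

(** Keeps the first, third, fifth, ... point of each colour. *)
Definition alternate : set nat :=
  [set n | ~~ odd (count (fun m => c m == c n) (iota 0 n))].

(** The unions of colour classes. *)
Definition saturated (B : set nat) : Prop :=
  forall m n, c m = c n -> B m -> B n.

(** The rounding is upwards because the first point of each colour is kept. *)
Lemma count_alternate t n :
  count (fun m => `[< alternate m >] && (c m == t)) (iota 0 n) =
  uphalf (count (fun m => c m == t) (iota 0 n)).
Proof.
elim: n => // n IH; rewrite -addn1 iotaD !count_cat /= IH add0n !addn0.
have [<-|] := eqVneq (c n) t; last by rewrite andbF !addn0.
rewrite andbT addn1 [RHS]uphalf_half /= addnC; congr (_ + _)%N.
by rewrite asboolb.
Qed.

Lemma count_color (P : pred nat) (s : seq nat) :
  count P s = (\sum_t count (fun m => P m && (c m == t)) s)%N.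
Proof.
elim: s => /= [|i s ->]; first by rewrite big1.
rewrite big_split /=; congr (_ + _)%N.
rewrite (bigD1 (c i)) //= eqxx andbT big1 ?addn0// => t tc.
by rewrite eq_sym (negbTE tc) andbF.
Qed.

(** Each colour occurring in [B] adds to the doubled count an excess of 0 or 1, the parity of its
    own count; the total excess is therefore at most the number of colours. *)
Lemma card_upto_alternate (B : set nat) n : saturated B ->
  (card_upto B n <= (card_upto (alternate `&` B) n).*2
    <= card_upto B n + #|T|)%N.
Proof.
(* [b] marks the colours that occur in [B]; by saturation [B] contains all points of these. *)
move=> Bsat; pose b t := `[< exists2 m, B m & c m = t >].
have bE m t : `[< B m >] && (c m == t) = b t && (c m == t).
  have [<-|] := eqVneq (c m) t; last by rewrite !andbF.
  rewrite !andbT; apply/asboolP/asboolP => [Bm|[k Bk ck]]; first by exists m.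
  exact: Bsat Bk.
have BE : card_upto B n =
    (\sum_(t | b t) count (fun m => c m == t) (iota 0 n))%N.
  rewrite card_uptoE count_color [RHS]big_mkcond; apply: eq_bigr => t _.
  rewrite (eq_count (fun m => bE m t)); case: (b t) => //=.
  exact: count_pred0.
have SBE : card_upto (alternate `&` B) n =
    (\sum_(t | b t) uphalf (count (fun m => c m == t) (iota 0 n)))%N.
  rewrite card_uptoE count_color [RHS]big_mkcond; apply: eq_bigr => t _.
  under eq_count do rewrite asbool_and -andbA bE andbCA.
  case: (b t) => /=; [exact: count_alternate|exact: count_pred0].
have -> : (card_upto (alternate `&` B) n).*2 = (\sum_(t | b t)
    odd (count (fun m => c m == t) (iota 0 n)) + card_upto B n)%N.
  rewrite SBE BE -muln2 big_distrl -big_split; apply: eq_bigr => t _ /=.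
  by rewrite muln2 uphalfK.
rewrite leq_addl addnC leq_add2l /=.
rewrite -sum1_card big_mkcond; apply: leq_sum => t _.
by case: ifP => // _; case: odd.
Qed.

(** The ratio differs from 1/2 by at most [#|T|] over twice the count of [B], and that count tends
    to infinity. *)
Lemma alternate_bisects (R : realType) (B : set nat) :
  saturated B -> infinite_set B -> bisects R alternate B.
Proof.
move=> Bsat Binf; apply/cvgrPdist_le => e e0.
have K0 : 0 <= #|T|%:R / e :> R by rewrite divr_ge0// ltW.
pose M := Num.Def.archi_bound (#|T|%:R / e :> R).
(* From [N] on, the count of [B] exceeds [M] and hence [#|T|%:R / e]; the successor also makes it
   positive. *)
have [N NB] := card_upto_infinite _ M.+1 Binf.
exists N => // n /= /NB; have /andP[] := card_upto_alternate _ n Bsat.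
set s := card_upto (alternate `&` B) n; set b := card_upto B n.
rewrite -(ler_nat R) => bs; rewrite -(ler_nat R) => sb.
move=> Mb; have b0 : (0 < b)%N by exact: leq_trans Mb.
have {}b0 : 0 < b%:R :> R by rewrite ltr0n.
have Kb : #|T|%:R <= e * b%:R :> R.
  rewrite mulrC -ler_pdivrMr//; apply: le_trans (ltW (archi_boundP K0)) _.
  by rewrite ler_nat ltnW.
rewrite -muln2 natrM in bs; rewrite -muln2 natrM natrD in sb.
have -> : 2^-1 - s%:R / b%:R = (b%:R - s%:R * 2) / (2 * b%:R) :> R.
  by field; rewrite gt_eqF.
rewrite normrM normfV (ger0_norm (ltW (_ : 0 < 2 * b%:R))) ?mulr_gt0//.
rewrite ler_pdivrMr ?mulr_gt0// ler_norml; apply/andP; split; nra.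
Qed.

End Coloring.

Lemma finite_bisecting_set (R : realType) (F : set (set nat)) : finite_set F ->
  exists S, forall B, generated_field F B -> infinite_set B -> bisects R S B.
Proof.
move=> /finite_seqP[s Fs].
(* Points of the same colour lie in the same generators, hence in the same members of the generated
   field. *)
pose c n := map_tuple (fun A : set nat => `[< A n >]) (in_tuple s).
exists (alternate c) => B FB; apply: alternate_bisects.
suff: generated_field F `<=` saturated c by exact.
apply: smallest_sub; last first.
  move=> A; rewrite Fs /= => As m n /(congr1 val)/= /eq_in_map/(_ A As) mn.
  by move=> /asboolP; rewrite mn => /asboolP.
split=> [//|A cA m n mn nAm An|A A' cA cA' m n mn [Am|A'm]].
- by apply: nAm; exact: cA An.
- by left; exact: cA Am.
- by right; exact: cA' A'm.
Qed.

(** * Maximal families and the comparison of the two cardinals *)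

Lemma pre_d_independent_extend (R : realType) (F : set (set nat))
    (S : set nat) :
  pre_d_independent R F ->
  (forall B, generated_field F B -> infinite_set B -> bisects R S B) ->
  d_independent R (S |` F) /\ F `<` S |` F.
Proof.
move=> indF bisS; have [] := pre_d_independent_setU1 _ _ _ indF bisS.
split; first by split=> //; exists S; left.
split; first by move=> A; right.
by move=> /(_ S (or_introl erefl)); exact: bisecting_set_notin indF bisS.
Qed.

(** Without a maximal family [i_d] would be the default [set0]. A set bisecting the field of the
    empty family gives a first d-independent family, and applying Zorn's lemma above it keeps the
    result nonempty. *)
Lemma exists_maximal_d_independent (R : realType) :
  exists F, maximal_d_independent R F.
Proof.
have [S bisS] := @finite_bisecting_set R set0 (finite_set0 _).
have [[_ FD F01 genD FM] _] :=
  pre_d_independent_extend _ _ _ (pre_d_independent0 R) bisS.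
have [M [[MD M01 MG MM] SM Mmax]] := Zorn_bigcup_above _ _
  (And4 FD F01 genD FM) (pre_d_independent_bigcup R).
exists M; split; first by split=> //; exists S; apply: SM; left.
by case=> G [[_ GD G01 genGD GM] MltG]; exact: Mmax MltG (And4 GD G01 genGD GM).
Qed.

Lemma maximal_d_independent_not_bisected (R : realType) (F : set (set nat)) :
  maximal_d_independent R F ->
  ~ exists S, forall B, generated_field F B -> infinite_set B -> bisects R S B.
Proof.
case=> -[_ FD F01 genD FM] Fmax [S bisS]; apply: Fmax; exists (S |` F).
exact: pre_d_independent_extend.
Qed.

Lemma maximal_d_independent_half_reaping (R : realType) (F : set (set nat)) :
  maximal_d_independent R F ->
  half_reaping R (generated_field F `&` [set B | infinite_set B]) /\
  generated_field F `&` [set B | infinite_set B] #<= F.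
Proof.
move=> maxF; have nbis := maximal_d_independent_not_bisected _ _ maxF; split.
  split=> [B []//|[S [_ SB]]]; apply: nbis; exists S => B FB Binf.
  exact: SB.
apply: card_le_trans (subset_card_le (@subIsetl _ _ _)) _.
apply: card_generated_field => Ffin; apply: nbis.
exact: finite_bisecting_set.
Qed.

Lemma min_cardP (P : set (set (set nat))) :
  P !=set0 -> least_cardinality P (min_card P).
Proof.
move=> /exists_least_card[F PF Fle].
by rewrite /min_card; apply: (xgetPex set0); exists F.
Qed.

Theorem theorem2p3 (R : realType) : r_half R #<= i_d R.
Proof.
(* [min_card] has its intended meaning on nonempty classes: a maximal family exists, and the reaping
   family obtained from the one chosen as [i_d] shows that the other class is nonempty too. *)
have [F maxF] := exists_maximal_d_independent R.
have [max_id _] := min_cardP _ (ex_intro _ F maxF).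
have [reap le] := maximal_d_independent_half_reaping _ _ max_id.
have [_ /(_ _ reap) rle] := min_cardP _ (ex_intro _ _ reap).
exact: card_le_trans rle le.
Qed.
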